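(* For every integer $n\ge 7$, $$s(n)\ \le\ 2\left\lceil\sqrt{(n-2)\ln(n-3)}\,\right\rceil+2.$$
   Context: Let $[n]=\{1,\ldots,n\}$ and let $\mathcal{S}_n$ be the set of all permutations of $[n]$, written as sequences $\mathbf{x}=x_1\ldots x_n$. For $1\le k\le n$, a $k$-minor of $\mathbf{x}\in\mathcal{S}_n$ is a subsequence of $\mathbf{x}$ of length $k$ (entries taken in increasing index positions) whose entries are renumbered by $1,2,\ldots,k$ preserving their relative order; it is thus an element of $\mathcal{S}_k$. The $k$-deck $D_k(\mathbf{x})$ is the multiset of all $\binom{n}{k}$ $k$-minors of $\mathbf{x}$ (one for each choice of $k$ index positions). A permutation $\mathbf{x}\in\mathcal{S}_n$ is $k$-reconstructible if no $\mathbf{y}\in\mathcal{S}_n$ with $\mathbf{y}\ne\mathbf{x}$ satisfies $D_k(\mathbf{y})=D_k(\mathbf{x})$. For a positive integer $n$, $s(n)$ denotes the least positive integer $k\le n$ such that every $\mathbf{x}\in\mathcal{S}_n$ is $k$-reconstructible. Here $\ln$ is the natural logarithm. *)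

(* Defs.v *)
From mathcomp Require Import all_boot.

Set Implicit Arguments.
Unset Strict Implicit.
Unset Printing Implicit Defensive.

(* The elements of S_n are the words x_1 ... x_n that rearrange 1, ..., n. *)
Definition perms (n : nat) : seq (seq nat) := permutations (iota 1 n).

(* For w without repetitions, the i-th smallest entry is replaced by i. *)
Definition renumber (w : seq nat) : seq nat :=
  [seq (index a (sort leq w)).+1 | a <- w].

(* A choice of k index positions is a bit mask of weight k. The deck is a
   multiset, so this list is only meaningful up to [perm_eq]. *)
Definition deck (k : nat) (x : seq nat) : seq (seq nat) :=
  [seq renumber (mask m x)
     | m : (size x).-tuple bool in [pred m : _.-tuple _ | count id m == k]].

Definition reconstructible (n k : nat) (x : seq nat) : bool :=
  ~~ has (fun y => (y != x) && perm_eq (deck k y) (deck k x)) (perms n).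

Definition all_reconstructible (n k : nat) : bool :=
  all (reconstructible n k) (perms n).

(* For n > 0 the default value n of the minimum is itself admissible, see
   [s_spec]; s 0 is a junk value. *)
Definition s (n : nat) : nat :=
  [arg min_(k < (ord_max : 'I_n.+1) | (0 < k) && all_reconstructible n k) k].

Lemma mem_perms n x : (x \in perms n) = perm_eq x (iota 1 n).
Proof. by rewrite /perms mem_permutations. Qed.

Lemma size_perms n x : x \in perms n -> size x = n.
Proof. by rewrite mem_perms => /perm_size ->; rewrite size_iota. Qed.

Lemma renumber_id n x : x \in perms n -> renumber x = x.
Proof.
rewrite mem_perms => xP; rewrite /renumber.
have -> : sort leq x = iota 1 n.
  apply: (sorted_eq leq_trans anti_leq); first exact: (sort_sorted leq_total).
    exact: iota_sorted.
  by rewrite perm_sort.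
apply: map_id_in => a.
rewrite (perm_mem xP) mem_iota; case: a => // a; rewrite add1n ltnS /= => an.
have e : nth 0 (iota 1 n) a = a.+1 by rewrite nth_iota.
by rewrite -{1}e index_uniq ?iota_uniq ?size_iota.
Qed.

Lemma deckP k x d :
  reflect (exists m : bitseq,
             [/\ size m = size x, count id m = k & d = renumber (mask m x)])
          (d \in deck k x).
Proof.
apply: (iffP imageP) => [[m mk ->]|[m [sm mk ->]]].
  by exists m; rewrite size_tuple; split=> //; apply/eqP.
by move/eqP: sm => sm; exists (Tuple sm) => //; apply/eqP.
Qed.

Lemma mem_deck_full n x d : x \in perms n -> (d \in deck n x) = (d == x).
Proof.
move=> xP; have sx := size_perms xP; apply/deckP/eqP => [[m [sm mn ->]]|->].
  have /all_pred1P m1 : all (pred1 true) m.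
    by rewrite (eq_all (a2 := id)) ?all_count ?mn ?sm ?sx //; case.
  by rewrite m1 mask_true ?sm // (renumber_id xP).
exists (nseq n true); rewrite size_nseq count_nseq mul1n; split=> //.
by rewrite mask_true ?sx // (renumber_id xP).
Qed.

Lemma all_reconstructible_full n : all_reconstructible n n.
Proof.
apply/allP => x xP; apply/hasPn => y yP; rewrite negb_and negbK.
case: (boolP (perm_eq _ _)) => [/perm_mem/(_ y)|]; last by rewrite orbT.
by rewrite !mem_deck_full // eqxx => <-.
Qed.

Lemma s_spec n : 0 < n ->
  [/\ 0 < s n, s n <= n, all_reconstructible n (s n)
    & forall k, 0 < k <= n -> all_reconstructible n k -> s n <= k].
Proof.
move=> n0; rewrite /s; case: arg_minnP => [|i /andP[i0 iP] imin].
  by rewrite n0 all_reconstructible_full.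
split=> //; first by rewrite -ltnS.
move=> k /andP[k0 kn] kP; have kn1 : k < n.+1 by [].
by apply: (imin (Ordinal kn1)); rewrite /= k0.
Qed.

(* Main.v *)
Require Import Defs.
From mathcomp Require Import all_boot all_order all_algebra.
From mathcomp Require Import reals exp.
From mathcomp Require Import ring lra zify sequences.
From mathcomp Require topology normedtype derive.
Import Order.TTheory GRing.Theory Num.Theory.

(** Write D(p) = x_p - y_p for two permutations x and y of [n] with the same
    k-deck, and k = d + 2. The proof plays two facts against each other.

    The deck kills moments: sum_p D(p) q(p) = 0 for every polynomial q of degree
    at most d ([deck_moments]). Indeed x_p - 1 is the number of entries smaller
    than x_p, and these split into the ones to the left and the ones to the
    right of p. Weighting every such pair of positions by a binomial coefficient
    'C(., l) in p gives a statistic whose sum over the k-minors of x is a nonzero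
    multiple of its value at x ([pair_stat_deck]), as long as l + 2 <= k.

    A vector with vanishing moments is long: if w on {0, ..., N} is orthogonal to
    all polynomials of degree at most d, then w_0^2 <= r |w|^2 with
    r = 'C(2N, N - d - 1) / 'C(2N, N) ([orthogonal_poly_norm]). The constant is
    the squared norm of the projection of the indicator of 0 on the complement
    of the polynomials; it is computed from an explicit reproducing polynomial
    ([reproducing_poly]), a discrete analogue of a Jacobi polynomial.

    Shift the first nonzero value of D, an integer, to the origin and take
    N = n - 1. As |D|^2 <= n^3, this gives 1 <= r n^3
    ([same_deck_binomial_ratio]). But r <= exp (- (d + 1)^2 / (N + 1/2))
    ([binomial_ratio_le]), and with d = 2m and m^2 >= (n - 2) ln (n - 3) the
    exponent exceeds 3 ln n in absolute value, once n >= 13. For n <= 12 the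
    claimed bound on s(n) is at least n. *)

(** * A statistic averaged over the deck *)

Lemma card_supersets (T : finType) (B : {set T}) k : #|B| <= k ->
  \sum_(A : {set T} | (B \subset A) && (#|A| == k)) 1
    = 'C(#|T| - #|B|, k - #|B|).
Proof.
move=> Bk; rewrite -[#|T|](cardsC B) addKn -cards_draws -sum1_card.
rewrite (reindex_onto (fun C => C :|: B) (fun A => A :\: B)) /=; last first.
  move=> A /andP[/subsetP BA _]; apply/setP => a; rewrite !inE.
  by case: (boolP (a \in B)) => [/BA ->|]; rewrite ?orbF.
apply: eq_bigl => C; rewrite inE subsetUr /=.
have -> : ((C :|: B) :\: B == C) = (C \subset ~: B).
  by rewrite setDUl setDv setU0 setDE; exact: (sameP eqP setIidPl).
rewrite andbC; case: (boolP (C \subset _)) => //= CB.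
have /eqP CB0 : C :&: B == set0 by rewrite setI_eq0 disjoints_subset.
by rewrite cardsU CB0 cards0 subn0; lia.
Qed.

(** Both sides count the pairs (A, U) with U an l-subset of A :&: Z: given U, the
    set A runs over the k-sets that contain P :|: U. *)
Lemma sum_bin_supersets (T : finType) (P Z : {set T}) k l :
  [disjoint P & Z] -> #|P| + l <= k ->
  \sum_(A : {set T} | (P \subset A) && (#|A| == k)) 'C(#|A :&: Z|, l)
    = 'C(#|Z|, l) * 'C(#|T| - (#|P| + l), k - (#|P| + l)).
Proof.
move=> PZ Plk.
transitivity (\sum_(A : {set T} | (P \subset A) && (#|A| == k))
  \sum_(U : {set T} | (U \subset Z) && (#|U| == l)) (U \subset A : nat)).
  apply: eq_bigr => A _; rewrite -cards_draws -sum1_card big_mkcond [RHS]big_mkcond.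
  apply: eq_bigr => U _; rewrite inE subsetI.
  by case: (U \subset A); case: (U \subset Z); case: (#|U| == l).
rewrite exchange_big /= -cards_draws -sum1_card big_distrl /=.
apply: eq_big => [U|U /andP[UZ /eqP Ul]]; first by rewrite inE.
have PU : #|P :|: U| = #|P| + l.
  rewrite cardsU Ul (_ : P :&: U = set0) ?cards0 ?subn0 //.
  by apply/eqP; rewrite setI_eq0; exact: disjointWr PZ.
rewrite mul1n -PU -card_supersets ?PU // [LHS]big_mkcond [RHS]big_mkcond.
apply: eq_bigr => A _; rewrite subUset.
by case: (P \subset A); case: (U \subset A); case: (#|A| == k).
Qed.

(** A pair of positions i, j with z_j < z_i counts with a weight that depends on
    which of the two comes first and with the number of l-subsets of the
    positions before i other than j: there are i - (j < i) such positions. *)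
Definition pair_stat (e : bool -> nat) (l : nat) (z : seq nat) : nat :=
  \sum_(i < size z) \sum_(j < size z)
    (nth 0 z j < nth 0 z i) * e (j < i) * 'C(i - (j < i), l).

Lemma nth_renumber_ltn (z : seq nat) i j : i < size z -> j < size z ->
  (nth 0 (renumber z) j < nth 0 (renumber z) i) = (nth 0 z j < nth 0 z i).
Proof.
move=> iz jz; rewrite /renumber !(nth_map 0) // ltnS.
have ss : sorted leq (sort leq z) by exact: (sort_sorted leq_total).
have mi h : h < size z -> nth 0 z h \in sort leq z.
  by rewrite mem_sort; exact: mem_nth.
apply/idP/idP => [lt|].
  rewrite ltn_neqAle (sorted_ltn_index leq_trans ss _ _ (mi j jz) (mi i iz) lt) andbT.
  by apply/eqP => e; rewrite e ltnn in lt.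
apply: contraLR; rewrite -!leqNgt => le.
exact: (sorted_leq_index leq_trans leqnn ss _ _ (mi i iz) (mi j jz) le).
Qed.

Lemma pair_stat_renumber e l z : pair_stat e l (renumber z) = pair_stat e l z.
Proof.
rewrite /pair_stat size_map; apply: eq_bigr => i _; apply: eq_bigr => j _.
by rewrite nth_renumber_ltn.
Qed.

(** Position p of s becomes position [count id (take p m)] of the masked word. *)
Lemma sum_mask (G : nat -> nat -> nat) (m : bitseq) (s : seq nat) :
  \sum_(i < size (mask m s)) G i (nth 0 (mask m s) i)
    = \sum_(p < size s) nth false m p * G (count id (take p m)) (nth 0 s p).
Proof.
elim: s m G => [|a s IH] [|b m] G; rewrite ?mask0 ?mask0s ?big_ord0 //=.
  by rewrite big1 // => p _; rewrite nth_nil.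
rewrite big_ord_recl /=; case: b => /=; last first.
  by rewrite mul0n add0n IH; apply: eq_bigr => p _.
rewrite big_ord_recl mul1n /= (IH m (fun i => G i.+1)).
by congr (_ + _); apply: eq_bigr => p _.
Qed.

Lemma count_take_sum (m : bitseq) h :
  count id (take h m) = \sum_(i < size m) (nth false m i && (i < h)).
Proof.
elim: m h => [|b m IH] [|h] /=; rewrite ?big_ord0 //.
  by rewrite big1 // => i _; rewrite andbF.
by rewrite big_ord_recl /= andbT IH.
Qed.

Lemma count_take_card n (m : n.-tuple bool) h :
  count id (take h m) = #|[set i | tnth m i] :&: [set i : 'I_n | i < h]|.
Proof.
rewrite count_take_sum size_tuple -sum1_card [RHS]big_mkcond.
by apply: eq_bigr => i _; rewrite !inE (tnth_nth false); case: andP.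
Qed.

Lemma ltn_count_take (m : bitseq) (p q : nat) : nth false m p -> nth false m q ->
  (count id (take q m) < count id (take p m)) = (q < p).
Proof.
have mono a b : nth false m a -> a < b -> count id (take a m) < count id (take b m).
  move=> ma ab; have am : a < size m.
    by rewrite ltnNge; apply: contraL ma => /(nth_default _) ->.
  rewrite -(subnKC ab) takeD count_cat (take_nth false) // -cats1 count_cat /= ma.
  by rewrite !addn1 addSn ltnS leq_addr.
move=> mp mq; case: (ltngtP q p) => [/mono->//|/mono h|->]; last by rewrite ltnn.
by apply/negbTE; rewrite -leqNgt ltnW // h.
Qed.

Lemma pair_stat_mask e l (x : seq nat) (m : (size x).-tuple bool) :
  let A := [set i | tnth m i] in
  pair_stat e l (mask m x)
    = \sum_(p < size x) \sum_(q < size x) ([set p; q] \subset A)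
        * ((nth 0 x q < nth 0 x p) * e (q < p)
            * 'C(#|A :&: [set i : 'I_(size x) | (i < p) && (i != q)]|, l)).
Proof.
move=> A; rewrite /pair_stat.
pose G i a := \sum_(j < size (mask m x))
   (nth 0 (mask m x) j < a) * e (j < i) * 'C(i - (j < i), l).
rewrite (sum_mask G); apply: eq_bigr => p _.
rewrite /G (sum_mask (fun j b => (b < nth 0 x p) * e (j < count id (take p m)) *
   'C(count id (take p m) - (j < count id (take p m)), l))) big_distrr.
apply: eq_bigr => q _ /=.
rewrite subUset !sub1set !inE !(tnth_nth false) -[(_ && _ : nat)]mulnb -mulnA.
case pA: (nth false m p); last by rewrite !mul0n.
case qA: (nth false m q); last by rewrite !mul0n.
rewrite !mul1n ltn_count_take // mulnA; congr (_ * _ * 'C(_, l)).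
rewrite count_take_card -/A (cardsD1 q) !inE (tnth_nth false) qA /= addKn.
by apply: eq_card => i; rewrite !inE; case: (i == q); rewrite ?andbF ?andbT.
Qed.

Lemma sum_deck (F : seq nat -> nat) k x :
  \sum_(z <- deck k x) F z =
  \sum_(A : {set 'I_(size x)} | #|A| == k)
     F (renumber (mask [tuple i \in A | i < size x] x)).
Proof.
rewrite /deck big_image.
pose T (A : {set 'I_(size x)}) := [tuple i \in A | i < size x].
rewrite (reindex_onto T (fun m => [set i | tnth m i])) /=; last first.
  by move=> m _; apply: eq_from_tnth => i; rewrite tnth_mktuple inE.
apply: eq_bigl => A.
have TA : [set i | tnth (T A) i] = A by apply/setP => i; rewrite inE tnth_mktuple.
rewrite TA eqxx andbT inE /=; congr (_ == _).
have := count_take_card _ (T A) (size x); rewrite TA take_oversize ?size_tuple // => ->.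
by apply: eq_card => i; rewrite !inE ltn_ord andbT.
Qed.

(** In a minor given by the set A of positions, the positions before p other than
    q become those of A :&: Z for a fixed set Z that avoids p and q, so that
    [sum_bin_supersets] sums the contribution of each pair (p, q) over all A. *)
Lemma pair_stat_deck e l k (x : seq nat) : l.+2 <= k ->
  \sum_(z <- deck k x) pair_stat e l z
    = 'C(size x - l.+2, k - l.+2) * pair_stat e l x.
Proof.
move=> lk; rewrite sum_deck.
under eq_bigr => A _ do rewrite pair_stat_renumber pair_stat_mask /=.
set n := size x.
have TA (A : {set 'I_n}) : [set i | tnth [tuple i \in A | i < n] i] = A.
  by apply/setP => i; rewrite inE tnth_mktuple.
under eq_bigr => A _ do rewrite TA.
rewrite exchange_big /pair_stat big_distrr /=; apply: eq_bigr => p _.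
rewrite exchange_big big_distrr /=; apply: eq_bigr => q _.
have [->|qp] := eqVneq q p.
  by rewrite ltnn !mul0n muln0 big1 // => A _; rewrite !mul0n muln0.
pose Z := [set i : 'I_n | (i < p) && (i != q)].
have dZ : [disjoint [set p; q] & Z].
  rewrite -setI_eq0; apply/eqP/setP => i; rewrite !inE.
  by case: eqP => [->|_]; rewrite ?ltnn //=; case: eqP; rewrite ?andbF.
have cpq : #|[set p; q]| = 2 by rewrite cards2 eq_sym qp.
have cZ : #|Z| = p - (q < p).
  have -> : Z = [set i : 'I_n | i < p] :\ q by apply/setP => i; rewrite !inE andbC.
  have cp : #|[set i : 'I_n | i < p]| = p.
    rewrite -sum1_card -[RHS]card_ord -sum1_card.
    rewrite (big_ord_widen n (fun=> 1)) ?(ltnW (ltn_ord p)) //.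
    by apply: eq_bigl => i; rewrite inE.
  by have := cardsD1 q [set i : 'I_n | i < p]; rewrite cp inE => h; rewrite {2}h addKn.
have := @sum_bin_supersets _ [set p; q] Z k l dZ.
rewrite cpq card_ord cZ => /(_ lk) h.
transitivity ((nth 0 x q < nth 0 x p) * e (q < p) *
  ('C(p - (q < p), l) * 'C(n - (2 + l), k - (2 + l)))); last by rewrite mulnA mulnC.
rewrite -h big_distrr /= big_mkcondl.
by apply: eq_bigr => A _; case: (_ \subset _); rewrite ?mul0n ?mul1n.
Qed.

Local Open Scope ring_scope.

(** * Falling factorials and moments *)

Definition ffact_poly (R : nzRingType) (l : nat) : {poly R} :=
  \prod_(j < l) ('X - (j%:R)%:P).

Lemma size_ffact_poly (R : nzRingType) l : size (ffact_poly R l) = l.+1.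
Proof.
by rewrite /ffact_poly size_prod_XsubC [index_enum _]unlock -enumT size_enum_ord.
Qed.

Lemma monic_ffact_poly (R : nzRingType) l : ffact_poly R l \is monic.
Proof. exact: monic_prod_XsubC. Qed.

Lemma horner_ffact_poly (R : comNzRingType) l (x : nat) :
  (ffact_poly R l).[x%:R] = (x ^_ l)%:R.
Proof.
elim: l => [|l IH]; first by rewrite /ffact_poly big_ord0 hornerE.
rewrite /ffact_poly big_ord_recr hornerM -/(ffact_poly R l) IH ffactnSr natrM.
rewrite hornerXsubC.
case: (leqP l x) => [lx|xl]; first by rewrite natrB.
by rewrite ffact_small // !mul0r.
Qed.

(** It suffices to test one polynomial of each degree, by descent on the degree. *)
Lemma moments_eq0 (R : fieldType) (I : finType) (c a : I -> R)
    (b : nat -> {poly R}) (d : nat) :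
  (forall l, size (b l) = l.+1) ->
  (forall l, (l < d)%N -> \sum_i c i * (b l).[a i] = 0) ->
  forall p : {poly R}, (size p <= d)%N -> \sum_i c i * p.[a i] = 0.
Proof.
move=> sb; elim: d => [|d IH] b0 p sp.
  move: sp; rewrite leqn0 size_poly_eq0 => /eqP ->.
  by apply: big1 => i _; rewrite horner0 mulr0.
pose t := p`_d / lead_coef (b d).
have lb : lead_coef (b d) != 0 by rewrite lead_coef_eq0 -size_poly_eq0 sb.
have sq : (size (p - t *: b d)%R <= d)%N.
  apply/leq_sizeP => j; rewrite coefB coefZ leq_eqVlt => /predU1P[<-|dj].
    have -> : (b d)`_d = lead_coef (b d) by rewrite lead_coefE sb.
    by rewrite divfK ?subrr.
  rewrite !nth_default ?sb ?mulr0 ?subrr //; exact: leq_trans sp _.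
have := IH (fun l h => b0 l (leqW h)) _ sq.
rewrite (eq_bigr (fun i => c i * p.[a i] - t * (c i * (b d).[a i]))); last first.
  by move=> i _; rewrite hornerD hornerN hornerZ mulrBr mulrCA.
by rewrite sumrB -mulr_sumr b0 // mulr0 subr0.
Qed.

(** The two factors count the ways to choose l elements below x and k above x
    in {0, ..., N}, so x is the (l+1)-st element of a (k+l+1)-subset. *)
Lemma sum_bin_convolution N k l :
  (\sum_(x < N.+1) 'C(x, l) * 'C(N - x, k) = 'C(N.+1, (k + l).+1))%N.
Proof.
elim: N k => [|N IH] k.
  by rewrite big_ord1 subn0 !bin0n; case: k l => [|k] [|l].
case: k => [|k].
  transitivity (\sum_(x < N.+1) 'C(x, l) * 'C(N - x, 0) + 'C(N.+1, l))%N.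
    rewrite big_ord_recr /= bin0 muln1; congr (_ + _)%N.
    by apply: eq_bigr => i _; rewrite !bin0.
  by rewrite IH binS add0n.
rewrite big_ord_recr /= subnn bin0n muln0 addn0.
rewrite (eq_bigr (fun x : 'I_N.+1 =>
  'C(x, l) * 'C(N - x, k.+1) + 'C(x, l) * 'C(N - x, k))%N).
  by rewrite big_split /= !IH addSn -binS.
by move=> x _; rewrite subSn ?binS ?mulnDr // -ltnS.
Qed.

(** For fixed d, N, l the right-hand side is, up to the constant N.+1`!, a
    polynomial in k of degree d, and it vanishes at k = N unless l = 0. *)
Lemma fact_fact_bin d N k l : (k <= d)%N -> (d <= N)%N -> (l <= d)%N ->
  ((d.+1 + k)`! * (N - k)`! * 'C(N.+1, (k + l).+1) =
   N.+1`! * ((d.+1 + k) ^_ (d - l) * (N - k) ^_ l))%N.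
Proof.
move=> kd dN ld; have kN := leq_trans kd dN.
have e1 : ((d.+1 + k) ^_ (d - l) * (k + l).+1`! = (d.+1 + k)`!)%N.
  rewrite -[RHS](@ffact_fact _ (d - l)).
    by congr (_ * _`!)%N; lia.
  by rewrite (leq_trans (leq_subr _ _)) // addSn leqW ?leq_addr.
case: (leqP (k + l) N) => [klN|Nkl].
  have e2 : ((N - k) ^_ l * (N - (k + l))`! = (N - k)`!)%N.
    by rewrite subnDA ffact_fact // leq_subRL.
  have := @bin_fact N.+1 (k + l).+1 klN; rewrite subSS => e3.
  by rewrite -e1 -e2 -e3; ring.
by rewrite bin_small // [((N - k) ^_ l)%N]ffact_small ?muln0 // ltn_subLR.
Qed.

(** * Permutations with the same deck have the same moments *)

(** The number of entries smaller than x_p to the left of p (for t = true) or to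
    the right of p (for t = false). *)
Definition smaller_entries (t : bool) (x : seq nat) (p : nat) : nat :=
  (\sum_(q < size x) (nth 0 x q < nth 0 x p) * ((q < p) == t))%N.

Lemma pair_stat_smaller_entries (t : bool) l (x : seq nat) :
  pair_stat (fun b => b == t) l x
    = (\sum_(p < size x) smaller_entries t x p * 'C(p - t, l))%N.
Proof.
apply: eq_bigr => p _; rewrite /smaller_entries big_distrl /=; apply: eq_bigr => q _.
by case: eqP => [->|]; rewrite ?muln0.
Qed.

Lemma smaller_entries_perms n x p : x \in perms n -> (p < n)%N ->
  (smaller_entries true x p + smaller_entries false x p).+1 = nth 0%N x p.
Proof.
move=> xP pn; have sx := size_perms xP; rewrite mem_perms in xP.
rewrite /smaller_entries -big_split /=.
transitivity (count (fun a => a < nth 0 x p)%N x).+1.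
  congr _.+1; rewrite -sum1_count (big_nth 0%N) big_mkord [RHS]big_mkcond.
  by apply: eq_bigr => q _; case: (_ < _)%N; case: (_ < _)%N.
have : nth 0%N x p \in x by rewrite mem_nth ?sx.
rewrite (perm_mem xP) (permP xP) mem_iota; move: (nth _ _ _) => v /andP[v1 vn].
have -> : iota 1 n = iota 1 v.-1 ++ iota v (n - v.-1).
  by rewrite -{1}(subnKC (_ : (v.-1 <= n)%N)) ?iotaD ?add1n ?prednK //; lia.
rewrite count_cat.
have /eqP -> : count (fun a => a < v)%N (iota 1 v.-1) == v.-1.
  rewrite -[X in _ == X](size_iota 1) -all_count.
  by apply/allP => a; rewrite mem_iota; lia.
have /eqP -> : count (fun a => a < v)%N (iota v (n - v.-1)) == 0%N.
  by rewrite -leqn0 leqNgt -has_count; apply/hasPn => a; rewrite mem_iota; lia.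
by rewrite addn0 prednK.
Qed.

Lemma deck_smaller_entries (R : numFieldType) (d n : nat) (x y : seq nat) (t : bool)
    (p : {poly R}) :
  x \in perms n -> y \in perms n -> (d.+2 <= n)%N ->
  perm_eq (deck d.+2 y) (deck d.+2 x) -> (size p <= d.+1)%N ->
  \sum_(i < n) ((smaller_entries t x i)%:R - (smaller_entries t y i)%:R)
    * p.[(i : nat)%:R] = 0.
Proof.
move=> xP yP dn dk sp; have sx := size_perms xP; have sy := size_perms yP.
have eqstat l : (l < d.+1)%N ->
    pair_stat (fun b => b == t) l x = pair_stat (fun b => b == t) l y.
  move=> ld; have := pair_stat_deck (fun b => b == t) l d.+2 x ld.
  rewrite -(perm_big _ dk) pair_stat_deck // sx sy => /eqP.
  by rewrite eqn_pmul2l ?bin_gt0 ?leq_sub2r // => /eqP.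
pose c (i : 'I_n) : R := (smaller_entries t x i)%:R - (smaller_entries t y i)%:R.
(* The nodes i - t are truncated only at i = 0 for t = true, where nothing lies
   to the left. *)
have c0 (i : 'I_n) : ~~ (t <= i)%N -> c i = 0.
  rewrite /c /smaller_entries; case: t {eqstat c} => //; case: i => -[] //= n0 _.
  by rewrite !big1 ?subrr // => q _; rewrite ?ltn0 muln0.
rewrite (eq_bigr (fun i : 'I_n =>
  c i * (p \Po ('X + t%:R%:P)).[((i - t)%N)%:R])); last first.
  move=> i _; rewrite horner_comp hornerD hornerX hornerC -natrD.
  case: (leqP t i) => [ti|it]; first by rewrite subnK.
  by rewrite -/(c i) c0 ?mul0r // -ltnNge.
have moment l : (l < d.+1)%N ->
    \sum_i c i * (ffact_poly R l).[((i - t)%N)%:R] = 0.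
  move=> /eqstat; rewrite !pair_stat_smaller_entries sx sy.
  move=> eqs; rewrite (eq_bigr (fun i : 'I_n =>
    (smaller_entries t x i * 'C(i - t, l))%:R * l`!%:R -
    (smaller_entries t y i * 'C(i - t, l))%:R * l`!%:R)).
    by rewrite sumrB -!mulr_suml -!natr_sum eqs subrr.
  by move=> i _; rewrite horner_ffact_poly -bin_ffact !natrM -mulrBl -mulrBl mulrA.
apply: (@moments_eq0 R _ c _ (ffact_poly R) d.+1) => //.
  exact: size_ffact_poly.
apply: leq_trans sp; have [->|p0] := eqVneq p 0; first by rewrite comp_poly0.
by rewrite size_comp_poly2 // size_XaddC.
Qed.

(** The two counts of [deck_smaller_entries] add up to x_p - 1. *)
Lemma deck_moments (R : numFieldType) (d n : nat) (x y : seq nat) (p : {poly R}) :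
  x \in perms n -> y \in perms n -> (d.+2 <= n)%N ->
  perm_eq (deck d.+2 y) (deck d.+2 x) -> (size p <= d.+1)%N ->
  \sum_(i < n) ((nth 0%N x i)%:R - (nth 0%N y i)%:R) * p.[(i : nat)%:R] = 0.
Proof.
move=> xP yP dn dk sp.
have split t := deck_smaller_entries R d n x y t p xP yP dn dk sp.
rewrite -[RHS](addr0 0) -[X in _ = X + _](split true) -[X in _ = _ + X](split false).
rewrite -big_split; apply: eq_bigr => i _ /=.
rewrite -(smaller_entries_perms n x i) // -(smaller_entries_perms n y i) //.
rewrite -!natr1 !natrD.
by ring.
Qed.

(** * Vectors orthogonal to the polynomials of low degree *)

(** A polynomial is determined by its values at 0, ..., d, by Lagrange
    interpolation. Only the existence of the coefficients matters below. *)
Lemma extrapolation (R : numFieldType) (d N : nat) :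
  exists c : 'I_d.+1 -> R, forall p : {poly R}, (size p <= d.+1)%N ->
    \sum_k c k * p.[(k : nat)%:R] = p.[N%:R].
Proof.
have inj : injective (fun i : nat => i%:R : R).
  by move=> i j /eqP; rewrite eqr_nat => /eqP.
exists (fun k => (tnth (@lagrange R d.+1 (fun i => i%:R)) k : {poly R}).[N%:R]).
move=> p sp.
rewrite {2}(lagrange_gen (ltn0Sn d) inj sp) horner_sum.
by apply: eq_bigr => k _; rewrite hornerM hornerC mulrC.
Qed.

Lemma horner_ffact_poly_up (R : comNzRingType) l (a k : nat) :
  (ffact_poly R l \Po ('X + a%:R%:P)).[k%:R] = ((a + k) ^_ l)%:R.
Proof.
by rewrite horner_comp hornerD hornerX hornerC -natrD addnC horner_ffact_poly.
Qed.

Lemma size_ffact_poly_up (R : idomainType) l (a : nat) :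
  size (ffact_poly R l \Po ('X + a%:R%:P)) = l.+1.
Proof. by rewrite size_comp_poly2 ?size_XaddC // size_ffact_poly. Qed.

Lemma horner_ffact_poly_down (R : comNzRingType) l (N k : nat) : (k <= N)%N ->
  (ffact_poly R l \Po (N%:R%:P - 'X)).[k%:R] = ((N - k) ^_ l)%:R.
Proof.
move=> kN.
by rewrite horner_comp hornerD hornerN hornerX hornerC -natrB // horner_ffact_poly.
Qed.

Lemma size_ffact_poly_down (R : idomainType) l (N : nat) :
  size (ffact_poly R l \Po (N%:R%:P - 'X)) = l.+1.
Proof.
by rewrite size_comp_poly2 ?size_ffact_poly // -opprB size_polyN size_XsubC.
Qed.

(** The polynomial g represents evaluation at 0 for the scalar product on
    {0, ..., N}. With c the extrapolation coefficients from 0, ..., d to N, it is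
    proportional to the sum over k <= d of
      c_k (d + 1 + k)! (N - k)! 'C(N - x, k).
    Pairing it with 'C(x, l) turns 'C(N - x, k) into 'C(N + 1, k + l + 1), by
    [sum_bin_convolution]; [fact_fact_bin] shows that the result is the
    extrapolation to N of a polynomial of degree d in k, which vanishes at N for
    l > 0. The value g(0) is the extrapolation of a monic polynomial of degree
    d + 1, which misses the true value at N by N (N - 1) ... (N - d). The quotient
    in the statement is 'C(2N, N - d - 1) / 'C(2N, N). *)
Lemma reproducing_poly (R : numFieldType) (d N : nat) : (d <= N)%N ->
  exists g : {poly R},
  [/\ (size g <= d.+1)%N,
      g.[0] = 1 - (N ^_ d.+1)%:R / ((N + d.+1) ^_ d.+1)%:R
    & forall p : {poly R}, (size p <= d.+1)%N ->
        \sum_(x < N.+1) g.[(x : nat)%:R] * p.[(x : nat)%:R] = p.[0]].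
Proof.
move=> dN; have [c cP] := extrapolation R d N.
have kN (k : 'I_d.+1) : (k <= N)%N by rewrite (leq_trans _ dN) // -ltnS.
pose S : R := (N`! * (N + d.+1) ^_ d.+1)%:R.
have S0 : S != 0 by rewrite pnatr_eq0 -lt0n muln_gt0 fact_gt0 ffact_gt0 leq_addl.
pose b (k : 'I_d.+1) : R := c k * ((d.+1 + k)`! * (N - k)`!)%:R / S.
pose g := \sum_k (b k / k`!%:R) *: (ffact_poly R k \Po (N%:R%:P - 'X)).
have gE x : (x <= N)%N -> g.[x%:R] = \sum_k b k * 'C(N - x, k)%:R.
  move=> xN; rewrite horner_sum; apply: eq_bigr => k _.
  rewrite hornerZ horner_ffact_poly_down // -bin_ffact natrM.
  by rewrite mulrCA mulrAC mulfK ?pnatr_eq0 -?lt0n ?fact_gt0 // mulrC.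
exists g; split.
- apply: leq_trans (size_sum _ _ _) _; apply/bigmax_leqP => k _.
  by apply: leq_trans (size_scale_leq _ _) _; rewrite size_ffact_poly_down.
- rewrite -[0]/(0%:R) gE // subn0.
  (* The subtracted term vanishes at the nodes 0, ..., d and lowers the degree. *)
  pose Q : {poly R} := ffact_poly R d.+1 \Po ('X + d.+1%:R%:P) - ffact_poly R d.+1.
  have sQ : (size Q <= d.+1)%N.
    apply/leq_sizeP => j; rewrite leq_eqVlt /Q coefB => /predU1P[<-|dj].
      have e1 : (ffact_poly R d.+1)`_d.+1 = lead_coef (ffact_poly R d.+1).
        by rewrite lead_coefE size_ffact_poly.
      have e2 : (ffact_poly R d.+1 \Po ('X + d.+1%:R%:P))`_d.+1
          = lead_coef (ffact_poly R d.+1 \Po ('X + d.+1%:R%:P)).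
        by rewrite lead_coefE size_ffact_poly_up.
      rewrite e1 e2 lead_coef_comp ?size_XaddC //.
      rewrite lead_coefDl ?size_polyX ?size_polyC; last by case: eqP.
      by rewrite lead_coefX expr1n mulr1 subrr.
    by rewrite !nth_default ?size_ffact_poly_up ?size_ffact_poly ?subrr.
  have := cP _ sQ.
  rewrite {2}/Q hornerD hornerN horner_ffact_poly_up horner_ffact_poly => QN.
  have e (k : 'I_d.+1) : b k * 'C(N, k)%:R = N`!%:R / S * (c k * Q.[(k : nat)%:R]).
    rewrite /Q hornerD hornerN horner_ffact_poly_up horner_ffact_poly.
    rewrite [(k ^_ d.+1)%N]ffact_small // subr0 /b.
    rewrite -(bin_fact (kN k)) -[(d.+1 + k)`!](@ffact_fact _ d.+1) ?leq_addr //.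
    rewrite addKn.
    by rewrite !natrM; ring.
  rewrite (eq_bigr _ (fun k _ => e k)) -mulr_sumr QN /S [(N + _)%N]addnC natrM.
  have h1 : N`!%:R != 0 :> R by rewrite pnatr_eq0 -lt0n fact_gt0.
  have h2 : ((d.+1 + N) ^_ d.+1)%:R != 0 :> R.
    by rewrite pnatr_eq0 -lt0n ffact_gt0 leq_addr.
  by rewrite invfM mulrA mulfV // mul1r [LHS]mulrC mulrBl mulfV.
- move=> p sp.
  have on_basis l : (l <= d)%N ->
      \sum_(x < N.+1) g.[(x : nat)%:R] * (ffact_poly R l).[(x : nat)%:R]
        = (l == 0%N)%:R.
    move=> ld.
    pose A : {poly R} := (ffact_poly R (d - l) \Po ('X + d.+1%:R%:P))
      * (ffact_poly R l \Po (N%:R%:P - 'X)).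
    have sA : (size A <= d.+1)%N.
      apply: leq_trans (size_polyMleq _ _) _.
      by rewrite size_ffact_poly_up size_ffact_poly_down addSn addnS /= subnK.
    have := cP _ sA; rewrite {2}/A hornerM horner_ffact_poly_up.
    rewrite horner_ffact_poly_down // subnn ffact0n => AN.
    transitivity (\sum_(x < N.+1) \sum_k
      b k * l`!%:R * ('C(x, l) * 'C(N - x, k))%:R).
      apply: eq_bigr => x _.
      have xN : (x <= N)%N by rewrite -ltnS.
      rewrite gE //.
      rewrite mulr_suml.
      apply: eq_bigr => k _.
      rewrite horner_ffact_poly -bin_ffact -!mulrA -!natrM.
      by rewrite [('C(x, l) * l`!)%N]mulnC mulnCA [('C(N - x, k) * _)%N]mulnC.
    rewrite exchange_big /=.
    rewrite (eq_bigr (fun k =>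
      l`!%:R * N.+1`!%:R / S * (c k * A.[(k : nat)%:R]))); last first.
      move=> k _; rewrite -mulr_sumr -natr_sum sum_bin_convolution /b /A.
      rewrite hornerM horner_ffact_poly_up horner_ffact_poly_down //.
      transitivity (c k * l`!%:R / S
        * ((d.+1 + k)`! * (N - k)`! * 'C(N.+1, (k + l).+1))%:R).
        by rewrite !natrM; ring.
      have kd : (k <= d)%N by rewrite -ltnS.
      rewrite (fact_fact_bin d N k l kd dN ld).
      move: (N.+1)`! ((d.+1 + k) ^_ (d - l))%N ((N - k) ^_ l)%N l`! => a1 a2 a3 a4.
      by rewrite !natrM; ring.
    rewrite -mulr_sumr AN; case: (eqVneq l 0%N) => [->|_]; last by rewrite !mulr0.
    rewrite mulr1 subn0 fact0 mul1r mulrAC -natrM.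
    rewrite (_ : _ * _ = N`! * (N + d.+1) ^_ d.+1)%N ?divff //.
    rewrite ffactnSr [(d.+1 + N)%N]addnC -addSnnS addnK factS.
    by rewrite [(N.+1 * _)%N]mulnC -mulnA [(N.+1 * _)%N]mulnC.
  pose cc (x : 'I_N.+1) := g.[(x : nat)%:R] - (x == ord0)%:R.
  have key (q : {poly R}) : \sum_x cc x * q.[(x : nat)%:R] =
     \sum_(x < N.+1) g.[(x : nat)%:R] * q.[(x : nat)%:R] - q.[0].
    rewrite (eq_bigr (fun x : 'I_N.+1 => g.[(x : nat)%:R] * q.[(x : nat)%:R]
      - (x == ord0)%:R * q.[(x : nat)%:R])); last by move=> x _; rewrite mulrBl.
    rewrite sumrB; congr (_ - _).
    rewrite (bigD1 ord0) //= mul1r big1 ?addr0 // => x /negPf ->.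
    by rewrite mul0r.
  apply/eqP; rewrite -subr_eq0 -key; apply/eqP.
  apply: (@moments_eq0 _ _ _ _ (ffact_poly R) d.+1) => //; first exact: size_ffact_poly.
  move=> l ld; rewrite key on_basis // -[0]/(0%:R) horner_ffact_poly ffact0n subrr //.
Qed.

(** With e the indicator of 0 and g the reproducing polynomial, u = e - g has
    squared norm 1 - g(0) = r, and w has the same scalar product w_0 with u as
    with e; conclude by Cauchy-Schwarz. *)
Lemma orthogonal_poly_norm (R : realFieldType) (d N : nat) (w : 'I_N.+1 -> R) :
  (d < N)%N ->
  (forall p : {poly R}, (size p <= d.+1)%N -> \sum_x w x * p.[(x : nat)%:R] = 0) ->
  w ord0 ^+ 2 <= (N ^_ d.+1)%:R / ((N + d.+1) ^_ d.+1)%:R * \sum_x w x ^+ 2.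
Proof.
move=> dN wP; have [g [sg g0 gP]] := reproducing_poly R d N (ltnW dN).
set r := _ / _ in g0 *.
have r0 : 0 < r by rewrite divr_gt0 // ltr0n ffact_gt0 ?leq_addl.
pose u (x : 'I_N.+1) := (x == ord0)%:R - g.[(x : nat)%:R].
have d0 (f : 'I_N.+1 -> R) : \sum_x (x == ord0)%:R * f x = f ord0.
  rewrite (bigD1 ord0) //= mul1r big1 ?addr0 // => x /negPf ->.
  by rewrite mul0r.
have uu : \sum_x u x ^+ 2 = r.
  rewrite (eq_bigr (fun x : 'I_N.+1 =>
    (x == ord0)%:R * (1 - 2 * g.[(x : nat)%:R])
      + g.[(x : nat)%:R] * g.[(x : nat)%:R])).
    by rewrite big_split /= d0 gP //= -[0%:R]/(0 : R) g0; ring.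
  by move=> x _; rewrite /u; case: eqP => _ /=; ring.
have wu : \sum_x w x * u x = w ord0.
  rewrite (eq_bigr (fun x : 'I_N.+1 =>
    (x == ord0)%:R * w x - w x * g.[(x : nat)%:R])).
    by rewrite sumrB d0 wP // subr0.
  by move=> x _; rewrite /u; ring.
have : 0 <= \sum_x (r * w x - w ord0 * u x) ^+ 2.
  by apply: sumr_ge0 => x _; exact: sqr_ge0.
rewrite (eq_bigr (fun x => r ^+ 2 * w x ^+ 2 - 2 * r * w ord0 * (w x * u x)
  + w ord0 ^+ 2 * u x ^+ 2)); last by move=> x _; ring.
rewrite big_split sumrB /= -!mulr_sumr wu uu => h.
rewrite -(ler_pM2l r0); nra.
Qed.

(** * Size of the binomial ratio *)

Section LogarithmBound.

Import topology normedtype derive numFieldNormedType.Exports.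

(** The function ln x + 4 / (x + 1) takes the value 2 at 1, and its derivative
    (x - 1)^2 / (x (x + 1)^2) is nonnegative. *)
Lemma ln_ge_ratio (R : realType) (v : R) : 1 <= v -> 2 * (v - 1) / (v + 1) <= ln v.
Proof.
move=> v1; pose f (x : R) := ln x + 4 / (x + 1).
have df (x : R) : 0 < x -> is_derive x (1 : R) f (x^-1 - 4 * (x + 1) ^- 2).
  move=> x0.
  have x1 : x + 1 != 0 by rewrite gt_eqF // addr_gt0.
  pose h := @is_derive1_ln R x x0.
  rewrite /f; apply: is_derive_eq.
  by rewrite /GRing.scale /=; field; rewrite x1 gt_eqF.
have dv : {in `[1, v], forall x, derivable f x 1}.
  move=> x; rewrite in_itv /= => /andP[x1 _].
  by have [] := df x (lt_le_trans ltr01 x1).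
have df1 (x : R) : x \in `]1, v[ -> is_derive x (1 : R) f (x^-1 - 4 * (x + 1) ^- 2).
  by rewrite in_itv /= => /andP[x1 _]; apply/df/(lt_trans ltr01).
have [c] := MVT_segment v1 df1 (derivable_within_continuous dv).
rewrite in_itv /= => /andP[c1 _] fv.
have c0 : 0 < c by exact: lt_le_trans c1.
have : 0 <= f v - f 1.
  rewrite fv mulr_ge0 ?subr_ge0 // -subr_ge0.
  have -> : c^-1 - 4 * (c + 1) ^- 2 = (c - 1) ^+ 2 / (c * (c + 1) ^+ 2).
    by field; rewrite !gt_eqF // addr_gt0.
  by rewrite divr_ge0 ?sqr_ge0 // mulr_ge0 ?sqr_ge0 // ltW.
rewrite -[X in _ -> is_true X]subr_ge0; congr (is_true (0 <= _)).
have v0 : v + 1 != 0 by rewrite gt_eqF // addr_gt0 // (lt_le_trans ltr01).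
by rewrite /f ln1; field.
Qed.

End LogarithmBound.

(** Going from e to e + 1 multiplies the ratio by
    (N - e) / (N + e + 1) = (a - b) / (a + b) with a = N + 1/2, b = e + 1/2, and
    ln ((a + b) / (a - b)) >= 2 b / a = ((e + 1)^2 - e^2) / a by [ln_ge_ratio]. *)
Lemma binomial_ratio_le (R : realType) (N e : nat) :
  (N ^_ e)%:R / ((N + e) ^_ e)%:R <= expR (- (e%:R ^+ 2 / (N%:R + 2^-1))) :> R.
Proof.
have a0 : 0 < N%:R + 2^-1 :> R by rewrite ltr_wpDl ?invr_gt0.
elim: e => [|e IH].
  by rewrite expr0n mul0r oppr0 expR0 !ffactn0 divr1.
rewrite ffactnSr addnS ffactSS.
have [eN|Ne] := ltnP e N; last first.
  by move: (Ne); rewrite -subn_eq0 => /eqP ->; rewrite muln0 mul0r expR_ge0.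
have -> : (N ^_ e * (N - e))%:R / ((N + e).+1 * (N + e) ^_ e)%:R =
    (N ^_ e)%:R / ((N + e) ^_ e)%:R * ((N - e)%:R / (N + e).+1%:R) :> R.
  by rewrite !natrM invfM [_^-1 * _]mulrC mulrACA.
have -> : - (e.+1%:R ^+ 2 / (N%:R + 2^-1)) =
    - (e%:R ^+ 2 / (N%:R + 2^-1)) - (2 * e%:R + 1) / (N%:R + 2^-1) :> R.
  by rewrite -natr1; ring.
rewrite expRD ler_pM ?divr_ge0 ?ler0n // {IH}.
have eN' : (e%:R + 1 <= N%:R :> R) by rewrite natr1 ler_nat.
have e0 : 0 <= e%:R :> R by rewrite ler0n.
have p0 : 0 < (N - e)%:R / (N + e).+1%:R :> R.
  by rewrite divr_gt0 ?ltr0n ?subn_gt0.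
rewrite -[X in X <= _]invrK expRN lef_pV2 ?posrE ?expR_gt0 ?invr_gt0 //.
rewrite -[X in _ <= X]lnK ?posrE ?invr_gt0 // ler_expR.
rewrite invf_div natrB ?(ltnW eN) // -[(N + e).+1%:R]natr1 natrD.
move: (N%:R) (e%:R) a0 eN' e0 => n h a0 eN' e0.
have d0 : 0 < n - h by lra.
have v1 : 1 <= (n + h + 1) / (n - h) by rewrite ler_pdivlMr // mul1r; lra.
apply: le_trans (ln_ge_ratio _ _ v1).
rewrite le_eqVlt; apply/orP; left; apply/eqP.
by field; rewrite !gt_eqF //; lra.
Qed.

(** Since 4 (n - 2) >= (7/2) (n - 1/2) for n >= 13, the exponent is at least
    (7/2) ln (n - 3), and (n - 3)^7 > n^6 makes this larger than 3 ln n. *)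
Lemma binomial_ratio_cube_lt1 (R : realType) (n e : nat) :
  (13 <= n)%N -> 4 * ((n%:R - 2) * ln (n%:R - 3)) <= e%:R ^+ 2 :> R ->
  (n.-1 ^_ e)%:R / ((n.-1 + e) ^_ e)%:R * (n%:R ^+ 3) < 1 :> R.
Proof.
move=> n13 he; have n13' : 13 <= n%:R :> R by rewrite (ler_nat R 13).
have n0 : 0 < n%:R :> R by lra.
have n3 : 0 < n%:R - 3 :> R by lra.
apply: le_lt_trans (_ : expR (- (e%:R ^+ 2 / (n.-1%:R + 2^-1))) * n%:R ^+ 3 < 1).
  by rewrite ler_pM2r ?exprn_gt0 // binomial_ratio_le.
have -> : n.-1%:R = n%:R - 1 :> R by rewrite -subn1 natrB // (leq_trans _ n13).
rewrite -[X in X ^+ 3]lnK ?posrE // -expRM_natl -expRD -[X in _ < X]expR0 ltr_expR.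
have lnn : 6 * ln n%:R < 7 * ln (n%:R - 3) :> R.
  rewrite !mulr_natl -!lnXn // ltr_ln ?posrE ?exprn_gt0 //.
  (* 13 (n - 3) >= 10 n for n >= 13, and 13^6 < 10^7. *)
  have h6 : (10 * n%:R) ^+ 6 <= (13 * (n%:R - 3)) ^+ 6 :> R.
    by rewrite lerXn2r ?nnegrE; lra.
  rewrite !exprMn in h6; rewrite [X in _ < X]exprS.
  have p6 : 0 < (n%:R - 3) ^+ 6 :> R by rewrite exprn_gt0.
  have p6' : 0 < n%:R ^+ 6 :> R by rewrite exprn_gt0.
  have t10 : 10 <= n%:R - 3 :> R by lra.
  have hA : 10 * (n%:R - 3) ^+ 6 <= (n%:R - 3) * (n%:R - 3) ^+ 6 :> R.
    by rewrite ler_pM2r.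
  move: ((n%:R - 3) ^+ 6) (n%:R ^+ 6) hA h6 p6 p6' => A B hA h6 p6 p6'.
  lra.
rewrite [_ * ln n%:R]mulrC addrC subr_lt0 ltr_pdivlMr; last by lra.
apply: lt_le_trans he.
have L0 : 0 < ln (n%:R - 3) :> R by rewrite ln_gt0 //; lra.
nra.
Qed.

(** * Conclusion *)

Lemma sum_shift (V : nmodType) (F : nat -> V) (n p : nat) :
  (forall j, (j < p)%N -> F j = 0) -> (forall j, (n <= j)%N -> F j = 0) ->
  \sum_(i < n) F (p + i)%N = \sum_(j < n) F j.
Proof.
move=> Fp Fn.
transitivity (\sum_(j < p + n) F j).
  rewrite big_split_ord /= [X in X + _]big1 ?add0r // => i _.
  exact: Fp.
rewrite addnC big_split_ord /= [X in _ + X]big1 ?addr0 // => i _.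
by rewrite Fn // leq_addr.
Qed.

(** Apply [orthogonal_poly_norm] to the differences x_j - y_j, shifted so that
    the first nonzero one sits at 0 and padded by zeros on the right: it is an
    integer, hence its square is at least 1, and all squares are at most n^2. *)
Lemma same_deck_binomial_ratio (R : realFieldType) (d n : nat) (x y : seq nat) :
  x \in perms n -> y \in perms n -> (d.+2 <= n)%N ->
  perm_eq (deck d.+2 y) (deck d.+2 x) -> y != x ->
  1 <= (n.-1 ^_ d.+1)%:R / ((n.-1 + d.+1) ^_ d.+1)%:R * n%:R ^+ 3 :> R.
Proof.
move=> xP yP dn dk yx; have sx := size_perms xP; have sy := size_perms yP.
have ex : exists j, nth 0%N x j != nth 0%N y j.
  case: (boolP [exists j : 'I_n, nth 0%N x j != nth 0%N y j]).
    by move=> /existsP[j]; exists j.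
  move=> /existsPn h; case/eqP: yx.
  apply: (@eq_from_nth _ 0%N); rewrite sy ?sx // => i ni.
  by have := h (Ordinal ni); rewrite negbK => /eqP ->.
have [p pP pmin] := ex_minnP ex.
pose D j : R := (nth 0%N x j)%:R - (nth 0%N y j)%:R.
have Dp j : (j < p)%N -> D j = 0.
  move=> jp; apply/eqP; rewrite subr_eq0 eqr_nat -[_ == _]negbK.
  apply/negP => /pmin.
  by rewrite leqNgt jp.
have Dn j : (n <= j)%N -> D j = 0.
  by move=> nj; rewrite /D !nth_default ?sx ?sy // subrr.
have Db j : D j ^+ 2 <= n%:R ^+ 2.
  case: (ltnP j n) => [jn|/Dn ->]; last by rewrite expr0n sqr_ge0.
  have b z : z \in perms n -> (nth 0%N z j <= n)%N.
    move=> zP; have : nth 0%N z j \in z by rewrite mem_nth // (size_perms zP).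
    move: zP; rewrite mem_perms => /perm_mem ->.
    by rewrite mem_iota add1n ltnS => /andP[].
  have bx : (nth 0%N x j)%:R <= n%:R :> R by rewrite ler_nat b.
  have by' : (nth 0%N y j)%:R <= n%:R :> R by rewrite ler_nat b.
  have x0 : 0 <= (nth 0%N x j)%:R :> R by rewrite ler0n.
  have y0 : 0 <= (nth 0%N y j)%:R :> R by rewrite ler0n.
  by rewrite /D; nra.
pose w (i : 'I_n.-1.+1) := D (p + i)%N.
have n1 : n.-1.+1 = n by rewrite prednK // (leq_trans _ dn).
have shift (F : nat -> R) : (forall j, D j = 0 -> F j = 0) ->
    \sum_(i < n.-1.+1) F (p + i)%N = \sum_(j < n) F j.
  by move=> DF; rewrite n1 sum_shift // => j hj; apply: DF; [exact: Dp | exact: Dn].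
have w_orth (q : {poly R}) : (size q <= d.+1)%N ->
    \sum_i w i * q.[(i : nat)%:R] = 0.
  move=> sq.
  have sq' : (size (q \Po ('X - p%:R%:P)) <= d.+1)%N.
    have [->|q0] := eqVneq q 0; first by rewrite comp_poly0 size_poly0.
    by rewrite size_comp_poly2 // size_XsubC.
  transitivity (\sum_(j < n) D j * (q \Po ('X - p%:R%:P)).[(j : nat)%:R]);
    last first.
    exact: (deck_moments R d n x y).
  rewrite -(shift (fun j => D j * (q \Po ('X - p%:R%:P)).[j%:R])); last first.
    by move=> j ->; rewrite mul0r.
  apply: eq_bigr => i _; congr (_ * _).
  by rewrite horner_comp hornerD hornerN hornerX hornerC natrD addrAC subrr add0r.
have dN : (d < n.-1)%N by rewrite -ltnS n1.
have := orthogonal_poly_norm R d n.-1 w dN w_orth.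
have w1 : 1 <= w ord0 ^+ 2.
  rewrite /w /D addn0; case: (ltngtP (nth 0%N x p) (nth 0%N y p)) pP => // lt _.
    have : (nth 0%N x p)%:R + 1 <= (nth 0%N y p)%:R :> R by rewrite natr1 ler_nat.
    by nra.
  have : (nth 0%N y p)%:R + 1 <= (nth 0%N x p)%:R :> R by rewrite natr1 ler_nat.
  by nra.
move=> /(le_trans w1)/le_trans; apply.
rewrite ler_wpM2l ?divr_ge0 ?ler0n //.
rewrite (shift (fun j => D j ^+ 2)); last by move=> j ->; rewrite expr0n.
apply: le_trans (_ : \sum_(j < n) n%:R ^+ 2 <= _); first by apply: ler_sum => j _.
by rewrite sumr_const card_ord [X in _ <= X]exprSr mulr_natr.
Qed.

Lemma all_reconstructible_large (R : realType) (n m : nat) :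
  (13 <= n)%N -> (m.*2.+2 <= n)%N ->
  (n%:R - 2) * ln (n%:R - 3) <= m%:R ^+ 2 :> R ->
  all_reconstructible n m.*2.+2.
Proof.
move=> n13 mn hm; apply/allP => x xP; apply/hasPn => y yP.
apply/negP => /andP[yx dk].
have := same_deck_binomial_ratio R _ _ _ _ xP yP mn dk yx.
rewrite leNgt binomial_ratio_cube_lt1 //.
have m0 : 0 <= m%:R :> R by rewrite ler0n.
rewrite -[(m.*2.+1)%:R]natr1 -addnn natrD; nra.
Qed.

(** For 7 <= n <= 12 the bounds ln (n - 3) >= 2 ln 2 >= 4/3, and
    ln (n - 3) >= 3 ln 2 >= 2 from n = 11 on, already force 2 m + 2 >= n. *)
Lemma order_ge13 (R : realType) (n m : nat) :
  (7 <= n)%N -> (m.*2.+2 < n)%N ->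
  (n%:R - 2) * ln (n%:R - 3) <= m%:R ^+ 2 :> R -> (13 <= n)%N.
Proof.
move=> n7 mn hm; rewrite leqNgt; apply/negP => n13.
have bound j : (2 ^ j + 3 <= n)%N -> ((n - 2) * (2 * j) <= 3 * m ^ 2)%N.
  move=> jn; have jn' : 2 ^+ j <= n%:R - 3 :> R.
    by rewrite lerBrDr -natrX -natrD ler_nat.
  have ln2 : 2 / 3 <= ln 2 :> R.
    have := ln_ge_ratio R 2 (ler1n _ 2).
    by have -> : 2 * (2 - 1) / (2 + 1) = 2 / 3 :> R by field.
  have lnn : j%:R * ln 2 <= ln (n%:R - 3) :> R.
    rewrite mulr_natl -lnXn // ler_ln // posrE ?exprn_gt0 //.
    by rewrite (lt_le_trans _ jn') ?exprn_gt0.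
  have n2 : 0 <= n%:R - 2 :> R by rewrite subr_ge0 (ler_nat R 2) (leq_trans _ n7).
  have j0 : 0 <= j%:R :> R by rewrite ler0n.
  rewrite -(ler_nat R) (natrM _ (n - 2)) (natrM _ 2) (natrM _ 3) natrX.
  rewrite natrB ?(leq_trans _ n7) //.
  have h1 : j%:R * (2 / 3) <= ln (n%:R - 3) :> R.
    by apply: le_trans lnn; rewrite ler_wpM2l.
  have h2 := le_trans (ler_wpM2l n2 h1) hm; lra.
have b2 := bound 2%N n7; have b3 : (11 <= n)%N -> _ := bound 3%N.
have m4 : (m <= 4)%N by lia.
by clear hm bound; case: m m4 mn b2 b3 => [|[|[|[|[|m]]]]] // _ mn b2 b3; lia.
Qed.

Theorem mainTheorem2 (R : realType) (n : nat) (hn : (7 <= n)%N) :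
  (s n)%:Z <= 2 * Num.ceil (Num.sqrt ((n%:R - 2) * ln (n%:R - 3)) : R) + 2.
Proof.
have n7 : 7 <= n%:R :> R by rewrite (ler_nat R 7).
set t : R := (n%:R - 2) * ln (n%:R - 3); set c := Num.ceil _.
have [sn0 sn sP smin] := s_spec (leq_trans (isT : (0 < 7)%N) hn).
have t0 : 0 <= t by rewrite mulr_ge0 ?ln_ge0 //; lra.
have c0 : 0 <= c by rewrite -(ler_int R) (le_trans (sqrtr_ge0 t)) // ceil_ge.
pose m := `|c|%N.
have cm : c = m%:Z by rewrite gez0_abs.
have tm : t <= m%:R ^+ 2.
  rewrite -[t]sqr_sqrtr // lerXn2r ?nnegrE ?sqrtr_ge0 ?ler0n //.
  have -> : m%:R = c%:~R :> R by rewrite cm.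
  exact: ceil_ge.
rewrite cm -[_ + _]/((2 * m + 2)%N%:Z) lez_nat mul2n addn2.
have [nm|mn] := leqP n m.*2.+2; first exact: leq_trans sn nm.
apply: smin; first by rewrite /= ltnW.
have n13 := order_ge13 R n m hn mn tm.
exact: (all_reconstructible_large R n m n13 (ltnW mn) tm).
Qed.
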